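(* Let $A \in \mathbb{R}^{n \times n}$ be of the form $$A = \begin{pmatrix} a_{1} & 0 & 0 & \cdots & 0 & 0 \\ 0 & a_{2}& 0 & \cdots & 0 &0 \\ 0 & 0 & a_{3} & \cdots & 0 & 0\\ \vdots & \vdots & \vdots & \ddots & \vdots & \vdots \\ 0 & 0 & 0 & \cdots & a_{n-1} & 0\\ c_{1} & c_{2} & c_{3} & \cdots & c_{n-1} & a_{n} \end{pmatrix}$$ and let $B = e_k b^T$ for some $b \in \mathbb{R}^n$ and some $k \in \{1, \ldots, n\}$. The pair $(A, B)$ is diagonally Riccati stable if and only if $\hat A + \bar B$ is Hurwitz.
   Context: $M \succ 0$ ($M \prec 0$) means that the real matrix $M=M^T$ is positive definite (negative definite). A pair $(A,B)$ of matrices in $\mathbb{R}^{n\times n}$ is diagonally Riccati stable if there exist diagonal $P \succ 0$, $Q \succ 0$ in $\mathbb{R}^{n \times n}$ with $A^TP+PA + Q + PBQ^{-1}B^TP \prec 0$. A real square matrix is Hurwitz if all its eigenvalues have negative real part. $e_1,\dots,e_n$ is the standard basis of $\mathbb{R}^n$. For $C \in \mathbb{R}^{n\times n}$, $\hat C$ is the matrix with $\hat c_{ii}=c_{ii}$ and $\hat c_{ij}=|c_{ij}|$ for $i\neq j$, and $\bar C$ is the matrix with $\bar c_{ij}=|c_{ij}|$ for all $i,j$. *)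

(* Defs.v *)
From HB Require Import structures.
From mathcomp Require Import all_boot all_order all_algebra.
From mathcomp Require Import reals.
From mathcomp Require Import complex.

Set Implicit Arguments.
Unset Strict Implicit.
Unset Printing Implicit Defensive.

Import Order.TTheory GRing.Theory Num.Theory.
Local Open Scope ring_scope.

Definition posdefmx (R : realType) (n : nat) (M : 'M[R]_n) : Prop :=
  M^T = M /\ forall x : 'cV[R]_n, x != 0 -> 0 < (x^T *m M *m x) 0 0.

Definition negdefmx (R : realType) (n : nat) (M : 'M[R]_n) : Prop :=
  M^T = M /\ forall x : 'cV[R]_n, x != 0 -> (x^T *m M *m x) 0 0 < 0.

Definition diag_riccati_stable (R : realType) (n : nat) (A B : 'M[R]_n) :
    Prop :=
  exists P Q : 'M[R]_n,
    [/\ is_diag_mx P, posdefmx P, is_diag_mx Q, posdefmx Q &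
        negdefmx (A^T *m P + P *m A + Q
                  + P *m B *m invmx Q *m B^T *m P)].

(* The eigenvalues are the complex ones: the real matrix is first mapped into
   R[i]. *)
Definition hurwitz (R : realType) (n : nat) (M : 'M[R]_n) : Prop :=
  forall z : R[i], eigenvalue (map_mx (real_complex R) M) z -> complex.Re z < 0.

Definition hat_mx (R : realType) (n : nat) (C : 'M[R]_n) : 'M[R]_n :=
  \matrix_(i, j) if i == j then C i j else `|C i j|.

Definition bar_mx (R : realType) (n : nat) (C : 'M[R]_n) : 'M[R]_n :=
  \matrix_(i, j) `|C i j|.

(* Main.v *)
Require Import Defs.
From HB Require Import structures.
From mathcomp Require Import all_boot all_order all_algebra.
From mathcomp Require Import reals.
From mathcomp Require Import complex.
From mathcomp Require Import polyrcf ring lra.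

Set Implicit Arguments.
Unset Strict Implicit.
Unset Printing Implicit Defensive.

Import Order.TTheory GRing.Theory Num.Theory.
Local Open Scope ring_scope.

(** Write M for hat A + bar B. Its off-diagonal entries are nonnegative, so it is
a Metzler matrix, and both implications compare quadratic forms.

If M is Hurwitz, there are positive vectors v and w with M v < 0 and M^T w < 0
([metzler_pos_vector]). Then P = diag (w_i / v_i) and
Q = diag (- (hat A^T w)_i / v_i) solve the Riccati inequality for (A, B), with
no assumption on the shape of A and B
([diag_riccati_stable_of_pos_vectors]). Indeed, at a vector x the Riccati form
is the value at y = Q^-1 B^T P x of
  x^T (A^T P + P A + Q) x + 2 x^T P B y - y^T Q y.
With x_i = v_i s_i and y_j = v_j t_j, bounding the terms of B and the off-diagonal
terms of A by 2 a s t <= |a| (s^2 + t^2) bounds this form by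
  sum_i w_i s_i^2 (M v)_i + sum_j v_j t_j^2 (M^T w)_j,
which is negative.

Conversely, the graph of the off-diagonal entries of A is a star, so a diagonal
matrix D of signs turns A into D A D = hat A ([star_mx_signature]). As B = e_k b^T,
the term P B Q^-1 B^T P is a multiple of e_k e_k^T that depends on the b_i only
through their squares: replacing B by bar B or conjugating by D does not change
it. Hence a solution P, Q for (A, B) is a solution for (hat A, bar B), and
2 x^T P bar B x <= x^T Q x + x^T P bar B Q^-1 bar B^T P x leaves
M^T P + P M < 0, so that M is Hurwitz by Lyapunov's theorem
([hurwitz_of_diag_lyapunov]). *)

(** * Positive vectors for Hurwitz Metzler matrices *)

Lemma monic_gt0_of_noroot (R : rcfType) (p : {poly R}) :
  p \is monic -> (forall t, 0 <= t -> ~~ root p t) ->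
  forall t, 0 <= t -> 0 < p.[t].
Proof.
move=> /monicP lp nr t t0.
have nr' : {in `[0, +oo[, forall x : R, ~~ root p x}.
  by move=> x; rewrite in_itv /= andbT; apply: nr.
have tin : t \in `[0, +oo[ by rewrite in_itv /= t0.
have := sgp_pinftyP nr' tin.
by rewrite /sgp_pinfty lp sgr1 => h; rewrite -sgr_gt0 h ltr01.
Qed.

(** The intermediate value theorem, in the form that propagates signs down to the
largest root below T. *)
Lemma poly_ge0_of_noroot (R : rcfType) (p : {poly R}) (y T : R) :
  y <= T -> 0 < p.[T] -> {in `]y, T[, forall z, ~~ root p z} -> 0 <= p.[y].
Proof.
move=> yT pT nr; rewrite leNgt; apply/negP => py.
have [|x xin rx] := @poly_ivtoo _ p y T yT; first by rewrite nmulr_rlt0.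
by move: (nr _ xin); rewrite rx.
Qed.

Definition metzler (R : numDomainType) (n : nat) (M : 'M[R]_n) : Prop :=
  forall i j, i != j -> 0 <= M i j.

(** Here (t I - M) u = chi 1. At an index where u vanishes, the row would read
- sum_j m_ij u_j = chi > 0 with every m_ij u_j >= 0: along the curve of solutions,
u cannot reach the boundary of the positive orthant. *)
Lemma metzler_resolvent_gt0 (R : rcfType) (n : nat) (M : 'M[R]_n) (t chi : R)
    (u : 'I_n -> R) :
  metzler M -> 0 < chi -> 
  (forall i, t * u i - \sum_j M i j * u j = chi) ->
  (forall i, 0 <= u i) -> forall i, 0 < u i.
Proof.
move=> mM chi0 hu u0 i; rewrite lt_def u0 andbT; apply/negP => /eqP ui.
have := hu i; rewrite ui mulr0 sub0r => h.
have : 0 <= \sum_j M i j * u j.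
  apply: sumr_ge0 => j _; have [<-|ij] := eqVneq i j; first by rewrite ui mulr0.
  by rewrite mulr_ge0 // mM.
by rewrite -oppr_le0 h leNgt chi0.
Qed.

(** A minimal entry u_i satisfies (t - sum_j m_ij) u_i >= chi > 0, since replacing
every u_j by u_i only lowers the off-diagonal part of the row. *)
Lemma metzler_resolvent_large (R : rcfType) (n : nat) (M : 'M[R]_n) (t chi : R)
    (u : 'I_n -> R) :
  metzler M -> 0 < chi -> (forall i, \sum_j M i j < t) ->
  (forall i, t * u i - \sum_j M i j * u j = chi) ->
  forall i, 0 < u i.
Proof.
move=> mM chi0 ht hu i0.
case: (@Order.TotalTheory.arg_minP _ _ _ i0 xpredT u isT) => i _ imin.
apply: lt_le_trans (imin i0 isT).
have h : (\sum_j M i j) * u i <= \sum_j M i j * u j.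
  rewrite mulr_suml; apply: ler_sum => j _.
  have [<-|ij] := eqVneq i j; first by [].
  by rewrite ler_wpM2l ?imin // mM.
have : 0 < (t - \sum_j M i j) * u i.
  rewrite mulrBl; apply: lt_le_trans chi0 _.
  by rewrite -(hu i) lerD2l lerN2.
by rewrite pmulr_rgt0 // subr_gt0.
Qed.

(** The vector u(t) = adj(t I - M) 1 has polynomial entries and solves
(t I - M) u(t) = chi(t) 1, where the characteristic polynomial chi is positive for
t >= 0. It is positive for large t, and it stays so down to t = 0: at the
largest root y of the product of its entries it would be nonnegative, hence
positive by [metzler_resolvent_gt0]. Then v = u(0) satisfies M v = - chi(0) 1. *)
Lemma metzler_pos_vector (R : rcfType) (n : nat) (M : 'M[R]_n) :
  metzler M -> (forall t, 0 <= t -> ~~ root (char_poly M) t) ->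
  exists2 v : 'I_n -> R, (forall i, 0 < v i) &
    forall i, \sum_j M i j * v j < 0.
Proof.
move=> mM nr.
pose u i := (\adj (char_poly_mx M) *m const_mx 1 : 'cV[{poly R}]_n) i 0.
have chi0 := monic_gt0_of_noroot (char_poly_monic M) nr.
have hu t i : t * (u i).[t] - \sum_j M i j * (u j).[t] = (char_poly M).[t].
  (* Row i of (X I - M) adj(X I - M) 1 = chi 1, evaluated at t. *)
  have := congr1 (fun N : 'cV[{poly R}]_n => (N i 0).[t])
    (mulmxA (char_poly_mx M) (\adj (char_poly_mx M)) (const_mx 1)).
  rewrite mul_mx_adj mul_scalar_mx [X in _ = X]/= !mxE mulr1 => <-.
  rewrite horner_sum.
  under [RHS]eq_bigr => j _ do
    rewrite -/(u j) !mxE hornerM hornerD hornerN hornerMn hornerX hornerC mulrBl.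
  rewrite sumrB; congr (_ - _).
  by rewrite (bigD1 i) //= eqxx mulr1n big1 ?addr0 // => j ji;
    rewrite eq_sym (negbTE ji) mulr0n mul0r.
pose T := 1 + \sum_i `|\sum_j M i j|.
have T0 : 0 <= T by rewrite addr_ge0 // sumr_ge0.
have uT : forall i, 0 < (u i).[T].
  apply: (metzler_resolvent_large mM (chi0 _ T0) _ (hu T)) => i.
  apply: le_lt_trans (ler_norm _) _.
  rewrite /T [X in _ < 1 + X](bigD1 i) //= addrCA ltrDl.
  by rewrite ltr_pwDl // sumr_ge0.
have step y : 0 <= y -> y <= T ->
    {in `]y, T[, forall z, ~~ root (\prod_i u i) z} -> forall i, 0 < (u i).[y].
  move=> y0 yT nry; apply: (metzler_resolvent_gt0 mM (chi0 _ y0) (hu y)) => i.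
  apply: (poly_ge0_of_noroot yT (uT i)) => z /nry; apply: contra.
  by rewrite (bigD1 i) //= rootM => ->.
suff u0 : forall i, 0 < (u i).[0].
  exists (fun i => (u i).[0]) => // i.
  by rewrite -oppr_gt0; have := hu 0 i; rewrite mul0r sub0r => ->; exact: chi0.
have : (\prod_i u i).[T] != 0.
  by rewrite horner_prod; apply/prodf_neq0 => i _; rewrite gt_eqF.
(* Any negative left end point works: a largest root y >= 0 is absurd by [step],
   and without one the product has no root z with 0 < z < T. *)
case: (prev_rootP (\prod_i u i) (-1) T) => [->|y _ ry|c _ _ nrc _].
- by rewrite horner0 eqxx.
- rewrite in_itv /= => /andP[_ yT] nry _.
  have [y0|y0] := lerP 0 y.
    have := step y y0 (ltW yT) nry => uy; exfalso; move/eqP: ry.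
    by rewrite horner_prod; apply/negP/prodf_neq0 => i _; rewrite gt_eqF.
  apply: step => // z; rewrite in_itv /= => /andP[z0 zT].
  by apply: nry; rewrite in_itv /= zT (lt_trans y0).
- apply: step => // z; rewrite in_itv /= => /andP[z0 zT].
  by apply: nrc; rewrite in_itv /= zT (lt_trans _ z0) // oppr_lt0.
Qed.

Lemma hurwitz_noroot (R : realType) (n : nat) (M : 'M[R]_n) :
  hurwitz M -> forall t, 0 <= t -> ~~ root (char_poly M) t.
Proof.
move=> hM t t0; apply/negP => rt.
have := hM (real_complex R t).
rewrite eigenvalue_root_char -map_char_poly fmorph_root => /(_ rt) /=.
by rewrite ltNge t0.
Qed.

Lemma char_poly_tr (R : comNzRingType) (n : nat) (M : 'M[R]_n) :
  char_poly M^T = char_poly M.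
Proof.
rewrite /char_poly -[in RHS]det_tr; congr (\det _).
by apply/matrixP => i j; rewrite !mxE eq_sym.
Qed.

(** * The Lyapunov inequality *)

(** For a left eigenvector u + i w of M with eigenvalue z, taking real and imaginary
parts of v M = z v gives
(u M P^-1 u^T) + (w M P^-1 w^T) = Re z (u P^-1 u^T + w P^-1 w^T). The left-hand side
is the value of x^T P M x at x = P^-1 u^T plus its value at x = P^-1 w^T, hence
negative. *)
Lemma hurwitz_of_diag_lyapunov (R : realType) (n : nat) (M : 'M[R]_n)
    (p : 'I_n -> R) :
  (forall i, 0 < p i) ->
  (forall x : 'I_n -> R, (exists i, x i != 0) ->
     \sum_i \sum_j p i * M i j * (x i * x j) < 0) ->
  hurwitz M.
Proof.
move=> p0 hM z /eigenvalueP [v vM v0].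
pose u i := complex.Re (v 0 i); pose w i := complex.Im (v 0 i).
have ReIm j : \sum_i u i * M i j = complex.Re z * u j - complex.Im z * w j /\
              \sum_i w i * M i j = complex.Re z * w j + complex.Im z * u j.
  have := congr1 (fun N : 'rV_n => N 0 j) vM; rewrite !mxE.
  have -> : \sum_k v 0 k * map_mx (real_complex R) M k j =
    Complex (\sum_k u k * M k j) (\sum_k w k * M k j).
    elim/big_rec3: _ => // i a b c _ ->.
    rewrite !mxE /u /w; case: (v 0 i) => r s /=.
    by apply/eqP; rewrite eq_complex /=; apply/andP; split; apply/eqP; ring.
  by rewrite /u /w; case: (v 0 j) => r s; case: (z) => e f [-> ->] /=.
have form (x : 'I_n -> R) : 
    \sum_i \sum_j p i * M i j * ((x i / p i) * (x j / p j)) =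
    \sum_j (\sum_i x i * M i j) * (x j / p j).
  rewrite exchange_big /=; apply: eq_bigr => j _; rewrite mulr_suml.
  by apply: eq_bigr => i _; field; rewrite !gt_eqF.
have sc_neg (x : 'I_n -> R) : (exists i, x i != 0) ->
    \sum_j (\sum_i x i * M i j) * (x j / p j) < 0.
  move=> [i xi]; rewrite -form; apply: (hM (fun i => x i / p i)); exists i.
  by rewrite mulf_neq0 // invr_eq0 gt_eqF.
have sc_le0 (x : 'I_n -> R) : \sum_j (\sum_i x i * M i j) * (x j / p j) <= 0.
  have [/existsP[i xi]|/existsPn x0] := boolP [exists i, x i != 0].
    by apply/ltW/sc_neg; exists i.
  by rewrite big1 // => j _; move: (x0 j); rewrite negbK => /eqP ->;
    rewrite mul0r mulr0.
have /rV0Pn[i vi] := v0.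
have : \sum_j (\sum_i u i * M i j) * (u j / p j) +
       \sum_j (\sum_i w i * M i j) * (w j / p j) < 0.
  have [ui|ui] := eqVneq (u i) 0; last first.
    by rewrite ltr_nwDl //; apply: sc_neg; exists i.
  rewrite ltr_nwDr //; apply: sc_neg; exists i.
  by apply: contra vi => /eqP wi; rewrite eq_complex; apply/andP; split; apply/eqP.
have -> : \sum_j (\sum_i u i * M i j) * (u j / p j) +
       \sum_j (\sum_i w i * M i j) * (w j / p j) =
       complex.Re z * \sum_j (u j ^+ 2 + w j ^+ 2) / p j.
  rewrite -big_split mulr_sumr; apply: eq_bigr => j _ /=.
  by have [-> ->] := ReIm j; ring.
rewrite !ltNge; apply: contra => zge; apply: mulr_ge0 => //.
by apply: sumr_ge0 => j _; rewrite divr_ge0 ?(ltW (p0 j)) // addr_ge0 ?sqr_ge0.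
Qed.

(** * The Riccati form of a diagonal pair *)

Lemma mx_formE (R : comNzRingType) (n : nat) (M : 'M[R]_n) (x : 'cV[R]_n) :
  (x^T *m M *m x) 0 0 = \sum_i \sum_j M i j * (x i 0 * x j 0).
Proof.
rewrite mxE exchange_big; apply: eq_bigr => j _ /=.
by rewrite mxE mulr_suml; apply: eq_bigr => i _; rewrite !mxE; ring.
Qed.

Lemma diag_formE (R : comNzRingType) (n : nat) (q : 'rV[R]_n) (x : 'cV[R]_n) :
  (x^T *m diag_mx q *m x) 0 0 = \sum_j q 0 j * x j 0 ^+ 2.
Proof.
by rewrite mul_mx_diag mxE; apply: eq_bigr => j _; rewrite !mxE; ring.
Qed.

Lemma posdef_diagP (R : realType) (n : nat) (q : 'rV[R]_n) :
  posdefmx (diag_mx q) <-> forall i, 0 < q 0 i.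
Proof.
split=> [[_ h] i|q0].
  have := h (delta_mx i 0); rewrite diag_formE (bigD1 i) //= mxE !eqxx big1.
    rewrite addr0 expr1n mulr1; apply; apply/eqP => /matrixP/(_ i 0)/eqP.
    by rewrite !mxE !eqxx oner_eq0.
  by move=> j ji; rewrite mxE (negbTE ji) expr0n mulr0.
split=> [|x x0]; first by rewrite tr_diag_mx.
have /cV0Pn[i xi] := x0.
rewrite diag_formE (bigD1 i) //= ltr_pwDl //.
  by rewrite mulr_gt0 // exprn_even_gt0.
by apply: sumr_ge0 => j _; rewrite mulr_ge0 ?sqr_ge0 // ltW.
Qed.

Lemma invmx_diag_mx (F : fieldType) (n : nat) (q : 'rV[F]_n) :
  (forall i, q 0 i != 0) -> invmx (diag_mx q) = diag_mx (map_mx GRing.inv q).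
Proof.
move=> q0.
have h : diag_mx q *m diag_mx (map_mx GRing.inv q) = 1%:M.
  rewrite mulmx_diag -diag_const_mx; congr diag_mx; apply/rowP => j.
  by rewrite !mxE mulfV.
have [uq _] := mulmx1_unit h.
by rewrite -[RHS](mulKmx uq) h mulmx1.
Qed.

Lemma riccati_formE (R : realType) (n : nat) (A B : 'M[R]_n) (p q : 'rV[R]_n)
    (x : 'cV[R]_n) :
  (forall i, 0 < q 0 i) ->
  (x^T *m (A^T *m diag_mx p + diag_mx p *m A + diag_mx q
      + diag_mx p *m B *m invmx (diag_mx q) *m B^T *m diag_mx p) *m x) 0 0 =
  2 * (\sum_i \sum_j p 0 i * A i j * (x i 0 * x j 0))
  + \sum_j q 0 j * x j 0 ^+ 2
  + \sum_j (\sum_i p 0 i * B i j * x i 0) ^+ 2 / q 0 j.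
Proof.
move=> q0; rewrite invmx_diag_mx => [|i]; last by rewrite gt_eqF.
rewrite !(mulmxDr, mulmxDl).
have sumE (a b c d : 'M[R]_1) :
  (a + b + c + d) 0 0 = a 0 0 + b 0 0 + c 0 0 + d 0 0 by rewrite !mxE.
rewrite sumE diag_formE.
have -> : x^T *m (A^T *m diag_mx p) *m x = (x^T *m (diag_mx p *m A) *m x)^T.
  by rewrite !trmx_mul trmxK tr_diag_mx !mulmxA.
have -> (a : 'M[R]_1) : a^T 0 0 = a 0 0 by rewrite mxE.
rewrite -[X in X + _ + _]mulr2n; congr (_ + _ + _).
  rewrite mx_formE -[LHS]mulr_natl; congr (2 * _).
  by apply: eq_bigr => i _; apply: eq_bigr => j _; rewrite mul_diag_mx !mxE.
pose z := B^T *m diag_mx p *m x.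
have -> : x^T *m (diag_mx p *m B *m diag_mx (map_mx GRing.inv q) *m B^T
    *m diag_mx p) *m x = z^T *m diag_mx (map_mx GRing.inv q) *m z.
  by rewrite /z !trmx_mul trmxK tr_diag_mx !mulmxA.
rewrite diag_formE; apply: eq_bigr => j _; rewrite mulrC !mxE; congr (_ ^+ 2 / _).
by apply: eq_bigr => i _; rewrite mul_mx_diag !mxE; ring.
Qed.

Lemma riccati_sym (R : realType) (n : nat) (A B : 'M[R]_n) (p q : 'rV[R]_n) :
  (forall i, 0 < q 0 i) ->
  let N := A^T *m diag_mx p + diag_mx p *m A + diag_mx q
      + diag_mx p *m B *m invmx (diag_mx q) *m B^T *m diag_mx p in N^T = N.
Proof.
move=> q0; rewrite /= invmx_diag_mx => [|i]; last by rewrite gt_eqF.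
rewrite 3!linearD /= !trmx_mul !trmxK !tr_diag_mx.
by rewrite !mulmxA [X in X + _ + _]addrC.
Qed.

Lemma mul2_le_norm (R : realFieldType) (a s t : R) :
  2 * (a * (s * t)) <= `|a| * (s ^+ 2 + t ^+ 2).
Proof.
have h1 : 0 <= (s - t) ^+ 2 by apply: sqr_ge0.
have h2 : 0 <= (s + t) ^+ 2 by apply: sqr_ge0.
by have [a0|a0] := ler0P a; nra.
Qed.

(** * Sufficiency for arbitrary A and B *)

(** The choice of Q is the one that makes the symmetric Metzler matrix with block
rows (hat A^T P + P hat A + Q, P bar B) and (bar B^T P, - Q) negative definite:
applied to the positive vector (v, v), it gives the negative vector (P M v, M^T w). *)
Lemma diag_riccati_stable_of_pos_vectors (R : realType) (n : nat)
    (A B : 'M[R]_n) (v w : 'I_n -> R) :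
  (forall i, 0 < v i) -> (forall i, 0 < w i) ->
  (forall i, \sum_j (hat_mx A + bar_mx B) i j * v j < 0) ->
  (forall j, \sum_i (hat_mx A + bar_mx B) i j * w i < 0) ->
  diag_riccati_stable A B.
Proof.
move=> v0 w0; set M := hat_mx A + bar_mx B => Mv Mw.
have ME i j : M i j = hat_mx A i j + `|B i j| by rewrite !mxE.
pose p : 'rV[R]_n := \row_i (w i / v i).
pose q : 'rV[R]_n := \row_j (- (\sum_i hat_mx A i j * w i) / v j).
have p0 i : 0 < p 0 i by rewrite mxE divr_gt0.
have q0 j : 0 < q 0 j.
  rewrite mxE divr_gt0 // oppr_gt0; apply: le_lt_trans (Mw j).
  by apply: ler_sum => i _; rewrite ler_wpM2r ?(ltW (w0 i)) // ME lerDl.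
exists (diag_mx p), (diag_mx q); split.
- exact: diag_mx_is_diag.
- exact/posdef_diagP.
- exact: diag_mx_is_diag.
- exact/posdef_diagP.
split=> [|x x0]; first exact: riccati_sym.
have /cV0Pn[i0 xi0] := x0.
rewrite riccati_formE //.
(* t is y = Q^-1 B^T P x rescaled by v; it makes the Riccati term equal to
   2 x^T P B y - y^T Q y. *)
pose s i := x i 0 / v i.
pose t j := (\sum_i p 0 i * B i j * x i 0) / q 0 j / v j.
have xE i : x i 0 = v i * s i by rewrite /s; field; rewrite gt_eqF.
have vqt j : v j * q 0 j = - \sum_i hat_mx A i j * w i.
  by rewrite mxE; field; rewrite gt_eqF.
have eqA : 2 * (\sum_i \sum_j p 0 i * A i j * (x i 0 * x j 0)) =
    \sum_i \sum_j w i * v j * (2 * (A i j * (s i * s j))).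
  rewrite mulr_sumr; apply: eq_bigr => i _; rewrite mulr_sumr.
  apply: eq_bigr => j _; rewrite !xE mxE; field; by rewrite gt_eqF.
have eqQ : \sum_j q 0 j * x j 0 ^+ 2 =
    \sum_i \sum_j w i * v j * (- (hat_mx A i j * s j ^+ 2)).
  rewrite exchange_big; apply: eq_bigr => j _ /=.
  transitivity (v j * q 0 j * (v j * s j ^+ 2)); first by rewrite xE; ring.
  rewrite vqt mulNr mulr_suml -sumrN.
  by apply: eq_bigr => i _; ring.
have eqB : \sum_j (\sum_i p 0 i * B i j * x i 0) ^+ 2 / q 0 j =
    \sum_i \sum_j w i * v j * (2 * (B i j * (s i * t j)) + hat_mx A i j * t j ^+ 2).
  rewrite exchange_big; apply: eq_bigr => j _ /=.
  have zE : \sum_i p 0 i * B i j * x i 0 = v j * q 0 j * t j.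
    by rewrite /t; field; rewrite !gt_eqF.
  transitivity (2 * (\sum_i p 0 i * B i j * x i 0) * (v j * t j)
      - v j * q 0 j * (v j * t j ^+ 2)).
    by rewrite zE; field; rewrite !gt_eqF.
  rewrite vqt mulNr opprK mulr_sumr !mulr_suml -big_split; apply: eq_bigr => i _ /=.
  by rewrite xE mxE; field; rewrite gt_eqF.
rewrite {}eqA {}eqQ {}eqB -!big_split /=.
have le_form : forall i j,
    w i * v j * (2 * (A i j * (s i * s j))) + w i * v j * (- (hat_mx A i j * s j ^+ 2))
    + w i * v j * (2 * (B i j * (s i * t j)) + hat_mx A i j * t j ^+ 2)
    <= w i * s i ^+ 2 * (M i j * v j) + v j * t j ^+ 2 * (M i j * w i).
  move=> i j.
  have leA : 2 * (A i j * (s i * s j)) <= hat_mx A i j * (s i ^+ 2 + s j ^+ 2).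
    rewrite mxE; case: eqP => [->|_]; last exact: mul2_le_norm.
    by rewrite le_eqVlt; apply/orP; left; apply/eqP; ring.
  have leB := mul2_le_norm (B i j) (s i) (t j).
  have wv : 0 <= w i * v j by rewrite mulr_ge0 // ltW.
  rewrite -!mulrDr.
  have -> : w i * s i ^+ 2 * (M i j * v j) + v j * t j ^+ 2 * (M i j * w i) =
    w i * v j * (M i j * (s i ^+ 2 + t j ^+ 2)) by ring.
  by rewrite ler_wpM2l // ME; lra.
have : \sum_i w i * s i ^+ 2 * (\sum_j M i j * v j)
     + \sum_j v j * t j ^+ 2 * (\sum_i M i j * w i) < 0.
  rewrite ltr_nwDl //; last first.
    apply: sumr_le0 => j _; rewrite mulr_ge0_le0 ?(ltW (Mw j)) //.
    by rewrite mulr_ge0 ?sqr_ge0 ?ltW.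
  rewrite (bigD1 i0) //= ltr_nwDl //; last first.
    apply: sumr_le0 => j _; rewrite mulr_ge0_le0 ?(ltW (Mv j)) //.
    by rewrite mulr_ge0 ?sqr_ge0 ?ltW.
  rewrite pmulr_rlt0 // mulr_gt0 // exprn_even_gt0 //=.
  by rewrite /s mulf_neq0 // invr_eq0 gt_eqF.
apply: le_lt_trans.
under [X in _ <= X + _]eq_bigr do rewrite mulr_sumr.
under [X in _ <= _ + X]eq_bigr do rewrite mulr_sumr.
rewrite [X in _ <= _ + X]exchange_big -big_split /=.
apply: ler_sum => i _; rewrite -!big_split /=; apply: ler_sum => j _.
exact: le_form.
Qed.

Lemma diag_riccati_stable_of_hurwitz (R : realType) (n : nat) (A B : 'M[R]_n) :
  hurwitz (hat_mx A + bar_mx B) -> diag_riccati_stable A B.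
Proof.
move=> hM; have nr := hurwitz_noroot hM.
have mM : metzler (hat_mx A + bar_mx B).
  by move=> i j ij; rewrite !mxE (negbTE ij) addr_ge0.
have [v v0 Mv] := metzler_pos_vector mM nr.
have [||w w0 Mw] := @metzler_pos_vector _ _ (hat_mx A + bar_mx B)^T.
- by move=> i j ij; rewrite mxE mM // eq_sym.
- by rewrite char_poly_tr.
apply: (diag_riccati_stable_of_pos_vectors v0 w0 Mv) => j.
by have := Mw j; under eq_bigr do rewrite mxE.
Qed.

(** * Necessity under a sign symmetry *)

(** The Riccati inequality for (A, B) is used at D x. There the A-part becomes
that of hat A, and (B^T P D x)_j = p_k b_j d_k x_k has the same square as
p_k |b_j| x_k. The cross terms of bar B are then absorbed by
2 r x_j <= q_j x_j^2 + r^2 / q_j with r = p_k |b_j| x_k. *)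
Lemma hurwitz_of_diag_riccati_stable (R : realType) (n : nat)
    (A B : 'M[R]_n) (d : 'I_n -> R) (b : 'cV[R]_n) (k : 'I_n) :
  (forall i, d i ^+ 2 = 1) ->
  (forall i j, hat_mx A i j = d i * A i j * d j) ->
  B = delta_mx k (0 : 'I_1) *m b^T ->
  diag_riccati_stable A B -> hurwitz (hat_mx A + bar_mx B).
Proof.
move=> d1 hd hB [P [Q [/diag_mxP [p ->] /posdef_diagP p0]]].
move=> [/diag_mxP [q ->] /posdef_diagP q0 [_ hR]].
have BE i j : B i j = (i == k)%:R * b j 0.
  by rewrite hB !mxE big_ord1 !mxE eqxx andbT.
apply: (@hurwitz_of_diag_lyapunov _ _ _ (fun i => p 0 i)) => // x [i0 xi0].
pose y : 'cV[R]_n := \col_i (d i * x i).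
have y0 : y != 0.
  apply/eqP => /colP/(_ i0)/eqP; rewrite !mxE mulf_eq0 (negbTE xi0) orbF => /eqP di.
  by have := d1 i0; rewrite di expr0n => /eqP; rewrite eq_sym oner_eq0.
have := hR y y0; rewrite riccati_formE // => hy.
have eqA : \sum_i \sum_j p 0 i * A i j * (y i 0 * y j 0) =
    \sum_i \sum_j p 0 i * hat_mx A i j * (x i * x j).
  apply: eq_bigr => i _; apply: eq_bigr => j _; rewrite hd !mxE; ring.
have sumB (f : 'I_n -> R) : \sum_i p 0 i * ((i == k)%:R * f i) = p 0 k * f k.
  rewrite (bigD1 k) //= eqxx mul1r big1 ?addr0 // => i ik.
  by rewrite (negbTE ik) mul0r mulr0.
have leB : 2 * (\sum_i \sum_j p 0 i * `|B i j| * (x i * x j)) <=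
    \sum_j q 0 j * y j 0 ^+ 2 + \sum_j (\sum_i p 0 i * B i j * y i 0) ^+ 2 / q 0 j.
  rewrite exchange_big mulr_sumr -big_split; apply: ler_sum => j _ /=.
  have -> : \sum_i p 0 i * `|B i j| * (x i * x j) = p 0 k * (`|b j 0| * (x k * x j)).
    rewrite -(sumB (fun i => `|b j 0| * (x i * x j))); apply: eq_bigr => i _.
    by rewrite BE normrM normr_nat; ring.
  have -> : \sum_i p 0 i * B i j * y i 0 = p 0 k * (b j 0 * y k 0).
    rewrite -(sumB (fun i => b j 0 * y i 0)); apply: eq_bigr => i _.
    by rewrite BE; ring.
  rewrite !exprMn !mxE !exprMn !d1 !mul1r -(real_normK (num_real (b j 0))).
  set r := p 0 k * `|b j 0| * x k.
  have -> : 2 * (p 0 k * (`|b j 0| * (x k * x j))) = 2 * (r * x j) by rewrite /r; ring.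
  have -> : p 0 k ^+ 2 * (`|b j 0| ^+ 2 * x k ^+ 2) = r ^+ 2 by rewrite /r; ring.
  rewrite -subr_ge0.
  have -> : q 0 j * x j ^+ 2 + r ^+ 2 / q 0 j - 2 * (r * x j) =
     (q 0 j * x j - r) ^+ 2 / q 0 j by field; rewrite gt_eqF.
  by rewrite divr_ge0 ?sqr_ge0 // ltW.
have -> : \sum_i \sum_j p 0 i * (hat_mx A + bar_mx B) i j * (x i * x j) =
    \sum_i \sum_j p 0 i * hat_mx A i j * (x i * x j)
    + \sum_i \sum_j p 0 i * `|B i j| * (x i * x j).
  rewrite -big_split; apply: eq_bigr => i _; rewrite -big_split.
  by apply: eq_bigr => j _; rewrite !mxE /=; ring.
by move: hy; rewrite eqA; lra.
Qed.

(** Each of the first m indices is joined only to the last one, so it can take the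
sign of its own coefficient c_j, while the last index takes the sign +1. *)
Lemma star_mx_signature (R : realType) (m : nat) (a c : 'rV[R]_m) (an : R) :
  let A := block_mx (diag_mx a) 0 c an%:M : 'M[R]_(m + 1) in
  exists2 d : 'I_(m + 1) -> R, forall i, d i ^+ 2 = 1 &
    forall i j, hat_mx A i j = d i * A i j * d j.
Proof.
move=> A.
exists (fun i => match split i with inl i' => if c 0 i' < 0 then -1 else 1
                               | inr _ => 1 end) => [i|i j].
  by case: (split i) => [i'|_]; [case: ifP => _|]; rewrite ?sqrrN expr1n.
rewrite mxE.
case: (split_ordP i) => i' ->; case: (split_ordP j) => j' ->;
  rewrite ?(eq_lshift, eq_rshift, eq_lrshift, eq_rlshift) 
    ?(block_mxEul, block_mxEur, block_mxEdl, block_mxEdr) ?mxE //=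
    ?(unsplitK (inl _)) ?(unsplitK (inr _)).
- have [->|_] := eqVneq i' j'; last by rewrite mulr0n normr0 mulr0 mul0r.
  by case: ifP => _; ring.
- by rewrite normr0 mulr0 mul0r.
- rewrite !ord1 mul1r; have [c0|c0] := ltrP (c 0 j') 0.
    by rewrite mulrN1 ltr0_norm.
  by rewrite mulr1 ger0_norm.
- by rewrite !ord1 eqxx mul1r mulr1.
Qed.

(* The size is n = m + 1: a collects a_1, ..., a_{n-1}, c collects
   c_1, ..., c_{n-1}, and an is the last diagonal entry a_n. *)
Theorem proposition3p4 (R : realType) (m : nat)
    (a c : 'rV[R]_m) (an : R) (b : 'cV[R]_(m + 1)) (k : 'I_(m + 1))
    (A B : 'M[R]_(m + 1))
    (hA : A = block_mx (diag_mx a) 0 c an%:M)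
    (hB : B = delta_mx k (0 : 'I_1) *m b^T) :
  diag_riccati_stable A B <-> hurwitz (hat_mx A + bar_mx B).
Proof.
split; last exact: diag_riccati_stable_of_hurwitz.
have [d d1 hd] := star_mx_signature a c an.
by apply: (hurwitz_of_diag_riccati_stable d1 _ hB); rewrite hA.
Qed.
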